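(* Consider random-order online weighted set cover, with a set system $(\mathcal{U}, \mathcal{S})$, $|\mathcal{U}| = n$, $|\mathcal{S}| = m$, and set costs $c_S \ge 0$. Assume the algorithm knows an estimate $\mathrm{Est}$ with $c(\mathrm{Opt}) \le \mathrm{Est} \le 2 c(\mathrm{Opt})$. Then the algorithm ROSC-OCO (described in the context) is $O(\log(mn))$-competitive: there is an absolute constant $C$ such that for every instance, $\mathbb{E}[c(\mathrm{Alg})] \le C \log(mn)\cdot c(\mathrm{Opt})$, where the expectation is over the uniformly random arrival order and the algorithm's internal randomness.
   Context: Random-order online set cover: an adversary fixes the set system and the costs; the elements of $\mathcal{U}$ then arrive one at a time in a uniformly random order. When an element arrives, the algorithm learns which sets contain it and must ensure that the element is covered by some set it has bought; bought sets cannot be removed. $c(\mathrm{Opt})$ is the minimum cost of a set cover, and $c(\mathrm{Alg})$ is the total cost of the sets bought by the algorithm. Notation: $\kappa_e$ is the cost of the cheapest set containing $e$; $X^t_e$ indicates that $e$ is still uncovered after the first $t-1$ steps; $\kappa^t_e = X^t_e \kappa_e$; $\overline{P} = \{p \in [0,1]^m : \langle c, p\rangle \le \mathrm{Est}\}$; $\mathcal{U}^t$ is the set of elements that have not arrived before time $t$, with $\mathcal{U}^1 = \mathcal{U}$. Algorithm ROSC-OCO maintains $p^t \in \overline{P}$ and at each time $t$ does the following: the next element $e^t$ arrives (it is uniform in $\mathcal{U}^t$); if $e^t$ is uncovered, it buys a cheapest set containing $e^t$, paying $\kappa^t_{e^t}$; it adds each set $S$ independently with probability $(\kappa^t_{e^t}/\mathrm{Est})\,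 p^t_S$; it then feeds the concave function $\mathrm{gain}_{t,e^t}(p) = (\kappa^t_{e^t}/\mathrm{Est}) \cdot \min(1, \sum_{S \ni e^t} p_S)$ (that is, its subgradient at $p^t$ as a stochastic gradient) to a stochastic online mirror descent algorithm over $\overline{P}$ with parameter $\eta = 1/2$, which outputs $p^{t+1} \in \overline{P}$. This OMD algorithm is one guaranteeing $\mathbb{E}[\sum_{t\le\tau} h_t(p^t)] \ge \frac12 \mathbb{E}[\sum_{t \le \tau} h_t(p^\star)] - O(\log m)$ for every $p^\star \in \overline{P}$ and every stopping time $\tau$, whenever the fed functions $h_t$ are nonnegative and concave with stochastic subgradients $H_t$ satisfying $H_{t,S}\in[0, c_S/\mathrm{Est}]$.
   Formalization: The bound is proved for instances with mn > 1: for m = n = 1 with a set of positive cost, log(mn) = 0 and the inequality fails for every C, and for an empty universe log(mn) is undefined. *)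

(* Defs.v *)
From HB Require Import structures.
From mathcomp Require Import all_boot all_order all_algebra all_fingroup.
From mathcomp Require Import reals exp.
Set Implicit Arguments.
Unset Strict Implicit.
Unset Printing Implicit Defensive.
Import Order.TTheory GRing.Theory Num.Theory.
Local Open Scope ring_scope.

(* Finite probability spaces.  A sigma-algebra on a finite sample space is
   given by the equivalence relation "belongs to the same atom". *)

Definition is_dist (R : realType) (W : finType) (Pr : W -> R) : Prop :=
  (forall w, 0 <= Pr w) /\ \sum_w Pr w = 1.

Definition expect (R : realType) (W : finType) (Pr X : W -> R) : R :=
  \sum_w Pr w * X w.

Definition cond_expect (R : realType) (W : finType) (Pr : W -> R)
    (F : rel W) (X : W -> R) (w : W) : R :=
  (\sum_(w' | F w w') Pr w' * X w') / (\sum_(w' | F w w') Pr w').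

Definition measurable_wrt (W : finType) (F : rel W) (T : Type) (X : W -> T) :
    Prop :=
  forall w w', F w w' -> X w = X w'.

(* F t is the information available after the first t steps. *)
Definition filtration (W : finType) (F : nat -> rel W) : Prop :=
  (forall t, equivalence_rel (F t)) /\ (forall t, subrel (F t.+1) (F t)).

(* The number of performed steps is tau; the event "tau <= t" is decided by
   the information available after t steps. *)
Definition stopping_time (W : finType) (F : nat -> rel W) (tau : W -> nat) :
    Prop :=
  forall t, measurable_wrt (F t) (fun w => tau w <= t)%N.

Definition dotp (R : realType) (m : nat) (u v : 'rV[R]_m) : R :=
  \sum_(S < m) u 0 S * v 0 S.

Definition concave_on (R : realType) (m : nat) (D : 'rV[R]_m -> Prop)
    (f : 'rV[R]_m -> R) : Prop :=
  forall p q l, D p -> D q -> 0 <= l <= 1 ->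
    l * f p + (1 - l) * f q <= f (l *: p + (1 - l) *: q).

(* g is a subgradient at p of the concave function f on D. *)
Definition subgradient_on (R : realType) (m : nat) (D : 'rV[R]_m -> Prop)
    (f : 'rV[R]_m -> R) (p g : 'rV[R]_m) : Prop :=
  forall q, D q -> f q <= f p + dotp g (q - p).

Definition Pbar (R : realType) (m : nat) (c : 'I_m -> R) (Est : R)
    (p : 'rV[R]_m) : Prop :=
  (forall S, 0 <= p 0 S <= 1) /\ \sum_(S < m) c S * p 0 S <= Est.

(* A process feeding an online learner: at step t (starting from t = 0) the
   learner, which has been given H 0, ..., H (t - 1), outputs
   oco [:: H 0; ...; H (t - 1)]. *)
Definition iterate (R : realType) (m : nat) (W : finType)
    (oco : seq 'rV[R]_m -> 'rV[R]_m) (H : nat -> W -> 'rV[R]_m)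
    (t : nat) (w : W) : 'rV[R]_m :=
  oco (mkseq (fun s => H s w) t).

(* h t is a random function known before step t, and H t is a stochastic
   subgradient of it: its conditional expectation given the past is almost
   surely a subgradient of h t at the point played by the learner. *)
Definition admissible_feed (R : realType) (m : nat) (c : 'I_m -> R) (Est : R)
    (oco : seq 'rV[R]_m -> 'rV[R]_m)
    (W : finType) (Pr : W -> R) (F : nat -> rel W)
    (h : nat -> W -> 'rV[R]_m -> R) (H : nat -> W -> 'rV[R]_m) : Prop :=
  [/\ forall t q, measurable_wrt (F t) (fun w => h t w q),
      forall t, measurable_wrt (F t.+1) (H t),
      forall t w, 0 < Pr w ->
        (forall p, Pbar c Est p -> 0 <= h t w p) /\
        concave_on (Pbar c Est) (h t w),
      forall t w S, 0 < Pr w -> 0 <= H t w 0 S <= c S / Est &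
      forall t w, 0 < Pr w ->
        subgradient_on (Pbar c Est) (h t w) (iterate oco H t w)
          (\row_S cond_expect Pr (F t) (fun w' => H t w' 0 S) w)].

(* The guarantee of the online mirror descent subroutine with parameter 1/2;
   the additive loss O(log m) is K * (1 + ln m), which also makes sense when
   m = 1. *)
Definition omd_guarantee (R : realType) (m : nat) (c : 'I_m -> R) (Est K : R)
    (oco : seq 'rV[R]_m -> 'rV[R]_m) : Prop :=
  (forall gs, Pbar c Est (oco gs)) /\
  forall (W : finType) (Pr : W -> R) (F : nat -> rel W)
    (h : nat -> W -> 'rV[R]_m -> R) (H : nat -> W -> 'rV[R]_m)
    (tau : W -> nat) (p : 'rV[R]_m),
    is_dist Pr -> filtration F -> stopping_time F tau ->
    admissible_feed c Est oco Pr F h H -> Pbar c Est p ->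
    2^-1 * expect Pr (fun w => \sum_(t < tau w) h t w p) - K * (1 + ln m%:R)
      <= expect Pr (fun w => \sum_(t < tau w) h t w (iterate oco H t w)).

(* A set system on the universe 'I_n is a family sets : 'I_m -> {set 'I_n};
   a subfamily is a set of indices. *)

Definition covered (n m : nat) (sets : 'I_m -> {set 'I_n}) (A : {set 'I_m})
    (e : 'I_n) : bool :=
  [exists S in A, e \in sets S].

Definition is_cover (n m : nat) (sets : 'I_m -> {set 'I_n})
    (A : {set 'I_m}) : bool :=
  [forall e, covered sets A e].

Definition cost (R : realType) (m : nat) (c : 'I_m -> R) (A : {set 'I_m}) : R :=
  \sum_(S in A) c S.

(* The default value, the whole family, is a cover on every feasible
   instance. *)
Definition opt (R : realType) (n m : nat) (sets : 'I_m -> {set 'I_n})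
    (c : 'I_m -> R) : R :=
  cost c [arg min_(A < [set: 'I_m] | is_cover sets A) cost c A]%O.

(* A tie-breaking rule selecting a cheapest set containing each element; the
   cost of the cheapest set containing e is then c (cheapest e). *)
Definition cheapest_rule (R : realType) (n m : nat)
    (sets : 'I_m -> {set 'I_n}) (c : 'I_m -> R) (cheapest : 'I_n -> 'I_m) :
    Prop :=
  forall e, e \in sets (cheapest e) /\
    forall S, e \in sets S -> c (cheapest e) <= c S.

(* The gain of p when the arriving element e costs k. *)
Definition gain (R : realType) (n m : nat) (sets : 'I_m -> {set 'I_n})
    (Est k : R) (e : 'I_n) (p : 'rV[R]_m) : R :=
  k / Est * Num.min 1 (\sum_(S < m | e \in sets S) p 0 S).

(* Gains are concave on the whole space, and subgradients are taken there;
   the rule picks one where the gain is not differentiable. *)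
Definition subgradient_rule (R : realType) (n m : nat)
    (sets : 'I_m -> {set 'I_n}) (c : 'I_m -> R) (Est : R)
    (subgrad : R -> 'I_n -> 'rV[R]_m -> 'rV[R]_m) : Prop :=
  forall k e p, 0 <= k -> Pbar c Est p ->
    subgradient_on (fun=> True) (gain sets Est k e) p (subgrad k e p).

Section ROSC_OCO.

Context (R : realType) (n m : nat) (sets : 'I_m -> {set 'I_n}) (c : 'I_m -> R)
  (Est : R) (cheapest : 'I_n -> 'I_m)
  (subgrad : R -> 'I_n -> 'rV[R]_m -> 'rV[R]_m)
  (oco : seq 'rV[R]_m -> 'rV[R]_m).

(* State between two steps: the sets bought so far, and the stochastic
   gradients fed so far to the online learner. *)
Record state := State { bought : {set 'I_m}; fed : seq 'rV[R]_m }.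

Definition init : state := State set0 [::].

Definition cur_p (st : state) : 'rV[R]_m := oco (fed st).

Definition cur_kappa (st : state) (e : 'I_n) : R :=
  if covered sets (bought st) e then 0 else c (cheapest e).

(* One step, when e arrives and A is the randomly sampled subfamily. *)
Definition step (st : state) (eA : 'I_n * {set 'I_m}) : state :=
  let: (e, A) := eA in
  let fallback :=
    if covered sets (bought st) e then set0 else [set cheapest e] in
  State (bought st :|: fallback :|: A)
        (rcons (fed st) (subgrad (cur_kappa st e) e (cur_p st))).

Definition incl_prob (st : state) (e : 'I_n) (S : 'I_m) : R :=
  cur_kappa st e / Est * cur_p st 0 S.

(* Sets are sampled independently. *)
Definition sample_prob (st : state) (e : 'I_n) (A : {set 'I_m}) : R :=
  \prod_(S < m) (if S \in A then incl_prob st e S else 1 - incl_prob st e S).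

(* An outcome consists of an arrival order (w.1 t is the element arriving at
   step t = 0, ..., n - 1) and of the subfamilies sampled at each step. *)
Definition outcome := ('S_n * {ffun 'I_n -> {set 'I_m}})%type.

Definition state_after (w : outcome) (t : nat) : state :=
  foldl step init (take t [seq (w.1 i, w.2 i) | i <- enum 'I_n]).

(* The order is uniform; the sampling distribution at each step depends on
   what happened before. *)
Definition law (w : outcome) : R :=
  (n`!%:R)^-1 * \prod_(t < n) sample_prob (state_after w t) (w.1 t) (w.2 t).

Definition alg_cost (w : outcome) : R := cost c (bought (state_after w n)).

Definition expected_alg_cost : R := \sum_(w : outcome) law w * alg_cost w.

End ROSC_OCO.

(* Main.v *)
(* Write rho for the total cost kappa of the cheapest sets of the uncovered
   elements.  A step pays kappa for the arriving element and, in expectation,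
   at most as much for the sampled sets, so the expected cost is at most
   2 Est times the expected total gain of an optimal cover; by the OMD guarantee
   it suffices to bound the total gain of the points p^t played.  Conditioned
   on the past, the arriving element is uniform among the remaining ones, and
   the gain of p^t is at most 4 times the expected value of
   (rho^t - rho^(t+1)) / (Est + rho^t): sampling makes rho drop by at least
   half the gain times rho, and covering the arriving element makes it drop by
   at least Est times the gain.  This is dominated by the drop of
   ln (Est + rho), whose total is at most ln (1 + n).  The shift by Est in the
   logarithm makes a stopping time unnecessary. *)

Require Import Defs.
From HB Require Import structures.
From mathcomp Require Import all_boot all_order all_algebra all_fingroup.
From mathcomp Require Import reals exp ring lra.
Import Order.TTheory GRing.Theory Num.Theory.
Local Open Scope ring_scope.
Set Implicit Arguments.
Unset Strict Implicit.
Unset Printing Implicit Defensive.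

(** * Uniform arrival orders with adaptively drawn samples *)

Section AdaptiveSampling.

Context (R : realType) (n : nat) (T : finType)
  (q : seq ('I_n * T) -> 'I_n -> T -> R).

Implicit Types (w : 'S_n * {ffun 'I_n -> T}) (t : nat) (B : T).

Definition history w t : seq ('I_n * T) :=
  take t [seq (w.1 i, w.2 i) | i <- enum 'I_n].

Definition adaptive_law w : R :=
  (n`!%:R)^-1 * \prod_(t < n) q (history w t) (w.1 t) (w.2 t).

Lemma history_rcons w (t : 'I_n) :
  history w t.+1 = rcons (history w t) (w.1 t, w.2 t).
Proof.
rewrite /history (take_nth (w.1 t, w.2 t)); last by rewrite size_map size_enum_ord.
by rewrite (nth_map t) ?size_enum_ord // nth_ord_enum.
Qed.

Lemma history_oversize w t :
  (n <= t)%N -> history w t = [seq (w.1 i, w.2 i) | i <- enum 'I_n].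
Proof. by move=> le_nt; rewrite /history take_oversize // size_map size_enum_ord. Qed.

Lemma eq_history w w' t :
  (forall i : 'I_n, (i < t)%N -> w.1 i = w'.1 i /\ w.2 i = w'.2 i) ->
  history w t = history w' t.
Proof.
elim: t => [|t IH] h; first by rewrite /history !take0.
have {}IH := IH (fun i hi => h i (ltnW hi)).
have [ltn|nlt] := ltnP t n.
  rewrite !(history_rcons _ (Ordinal ltn)) /= IH.
  by have [-> ->] := h (Ordinal ltn) (ltnSn t).
by move: IH; rewrite !history_oversize // leqW.
Qed.

Definition resample w (t : 'I_n) B : 'S_n * {ffun 'I_n -> T} :=
  (w.1, [ffun i => if i == t then B else w.2 i]).

Lemma history_resample w (t : 'I_n) B s :
  (s <= t)%N -> history (resample w t B) s = history w s.
Proof.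
move=> le_st; apply: eq_history => i lt_is; split=> //=.
by rewrite ffunE -val_eqE /= ltn_eqF // (leq_trans lt_is).
Qed.

(** Exchanging [B] with the value it overwrites is an involution on the pairs [(w, B)], so every
    outcome is hit once for each value of [T]. *)
Lemma sum_resample (t : 'I_n) (f : 'S_n * {ffun 'I_n -> T} -> R) :
  \sum_w \sum_B f (resample w t B) = #|T|%:R * \sum_w f w.
Proof.
pose swap (x : ('S_n * {ffun 'I_n -> T}) * T) := (resample x.1 t x.2, x.1.2 t).
have swapK : involutive swap.
  move=> [[s a] B]; rewrite /swap /resample /= ffunE eqxx; congr (_, _, _).
  by apply/ffunP => i; rewrite !ffunE; case: eqP => // ->.
rewrite pair_bigA /= (reindex_inj (inv_inj swapK)) /=.
rewrite -(pair_bigA _ (fun w B => f (resample (resample w t B) t (w.2 t)))) /=.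
rewrite mulr_sumr; apply: eq_bigr => w _.
rewrite (eq_bigr (fun=> f w)) ?sumr_const ?mulr_natl // => B _; congr f.
case: w => s a; rewrite /resample /=; congr (_, _).
by apply/ffunP => i; rewrite !ffunE; case: eqP => // ->.
Qed.

(** What is left of the product in [adaptive_law] once the samples from time [t] on have been summed
    out. *)
Definition prefix_weight t w : R :=
  \prod_(i < n | (i < t)%N) q (history w i) (w.1 i) (w.2 i).

Lemma prefix_weightS (t : 'I_n) w :
  prefix_weight t.+1 w = prefix_weight t w * q (history w t) (w.1 t) (w.2 t).
Proof.
rewrite /prefix_weight (bigD1 t) //= mulrC; congr (_ * _).
by apply: eq_bigl => i; rewrite ltnS ltn_neqAle andbC.
Qed.

Lemma prefix_weight_resample (s : nat) (t : 'I_n) w B :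
  (s <= t)%N -> prefix_weight s (resample w t B) = prefix_weight s w.
Proof.
move=> le_st; apply: eq_bigr => i lt_is.
have lt_it := leq_trans lt_is le_st.
by rewrite history_resample 1?ltnW //= ffunE -val_eqE /= ltn_eqF.
Qed.

Hypothesis q_sum1 : forall hs e, \sum_B q hs e B = 1.
Hypothesis T_gt0 : (0 < #|T|)%N.

(* The sampled values from time [t] on are unnormalised: each contributes a
   factor [#|T|]. *)
Lemma expect_prefix t (f : 'S_n * {ffun 'I_n -> T} -> R) :
  (t <= n)%N ->
  (forall w (i : 'I_n) B, (t <= i)%N -> f (resample w i B) = f w) ->
  expect adaptive_law f =
    (n`!%:R)^-1 * #|T|%:R ^- (n - t) * \sum_w prefix_weight t w * f w.
Proof.
have N0 : #|T|%:R != 0 :> R by rewrite pnatr_eq0 -lt0n.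
(* Downward induction on [t], run on [d = n - t]: going from [t.+1] to [t] sums out the single
   sample drawn at time [t]. *)
move=> le_tn; move: {2}(n - t)%N (erefl (n - t)%N) le_tn => d.
elim: d t => [|d IH] t dE le_tn f_inv.
  have -> : t = n by apply/eqP; rewrite eqn_leq le_tn -subn_eq0 dE.
  rewrite subnn expr0 invr1 mulr1 /expect mulr_sumr; apply: eq_bigr => w _.
  rewrite /adaptive_law -mulrA; congr (_ * (_ * _)).
  by apply: eq_bigl => i; rewrite ltn_ord.
have lt_tn : (t < n)%N by rewrite -subn_gt0 dE.
rewrite (IH t.+1) ?subnS ?dE //; last by move=> w i B /ltnW; apply: f_inv.
rewrite -[RHS]mulrA -[LHS]mulrA; congr (_ * _); rewrite /= exprS invfM.
rewrite -[RHS]mulrA [RHS]mulrCA; congr (_ * _).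
apply: (mulfI N0); rewrite mulrA divff // mul1r.
rewrite -(sum_resample (Ordinal lt_tn)); apply: eq_bigr => w _.
under eq_bigr => B _.
  rewrite (prefix_weightS (Ordinal lt_tn)) prefix_weight_resample //.
  rewrite history_resample // f_inv //= ffunE eqxx mulrAC.
  over.
by rewrite -mulr_sumr q_sum1 mulr1.
Qed.

(** This says that [q] is the conditional law of the sample at time [t]. The left side reduces to
    prefixes of length [t.+1], the right side to prefixes of length [t], and summing over the sample
    at time [t] links them. *)
Lemma expect_sample (t : 'I_n) (g : seq ('I_n * T) -> 'I_n -> T -> R) :
  expect adaptive_law (fun w => g (history w t) (w.1 t) (w.2 t)) =
  expect adaptive_law
    (fun w => \sum_B q (history w t) (w.1 t) B * g (history w t) (w.1 t) B).
Proof.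
have N0 : #|T|%:R != 0 :> R by rewrite pnatr_eq0 -lt0n.
rewrite (@expect_prefix t.+1) //; last first.
  move=> w i B lt_ti; rewrite history_resample 1?ltnW //= ffunE.
  by rewrite -val_eqE /= ltn_eqF.
rewrite (@expect_prefix t) 1?ltnW //; last first.
  by move=> w i B le_ti; rewrite history_resample.
rewrite -(subnSK (ltn_ord t)) -[RHS]mulrA -[LHS]mulrA; congr (_ * _).
rewrite exprS invfM -[RHS]mulrA [RHS]mulrCA; congr (_ * _).
apply: (mulfI N0); rewrite mulrA divff // mul1r.
rewrite -(sum_resample t); apply: eq_bigr => w _.
rewrite mulr_sumr; apply: eq_bigr => B _.
rewrite (prefix_weightS t) prefix_weight_resample //.
by rewrite history_resample //= ffunE eqxx mulrA.
Qed.

(* Transposing the positions [t] and [j >= t] of the arrival order preserves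
   the history before [t], so the element at position [t] is equidistributed
   with the one at position [j]. *)
Lemma expect_arrival (t : 'I_n) (g : seq ('I_n * T) -> 'I_n -> R) :
  (forall w (i : 'I_n), (i < t)%N -> g (history w t) (w.1 i) = 0) ->
  expect adaptive_law (fun w => g (history w t) (w.1 t)) =
  expect adaptive_law (fun w => (n - t)%:R^-1 * \sum_e g (history w t) e).
Proof.
move=> g0; have nt0 : (n - t)%:R != 0 :> R by rewrite pnatr_eq0 subn_eq0 -ltnNge.
rewrite !(@expect_prefix t) 1?ltnW //; try by move=> w i B le_ti; rewrite history_resample.
congr (_ * _); apply: (mulfI nt0).
transitivity (\sum_(j < n | (t <= j)%N)
    \sum_w prefix_weight t w * g (history w t) (w.1 j)).
  rewrite [RHS](eq_bigr (fun=> \sum_w prefix_weight t w * g (history w t) (w.1 t))).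
    by rewrite -(big_geq_mkord _ _ predT (fun=> \sum_w _)) sumr_const_nat mulr_natl.
  move=> j le_tj.
  pose tr (w : 'S_n * {ffun 'I_n -> T}) := ((tperm t j * w.1)%g, w.2).
  have trK : involutive tr by move=> [s a]; rewrite /tr /= mulgA tperm2 mul1g.
  have trE w (i : 'I_n) : (i < t)%N -> (tr w).1 i = w.1 i.
    move=> lt_it; rewrite /= permM tpermD // -val_eqE /= gtn_eqF //.
    exact: leq_trans le_tj.
  have trH w s : (s <= t)%N -> history (tr w) s = history w s.
    by move=> le_st; apply: eq_history => i lt_is; rewrite trE ?(leq_trans lt_is).
  rewrite [LHS](reindex_inj (inv_inj trK)); apply: eq_bigr => w _.
  rewrite trH //= permM tpermR; congr (_ * _); apply: eq_bigr => i lt_it.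
  by rewrite trH 1?ltnW // trE.
rewrite exchange_big /= mulr_sumr; apply: eq_bigr => w _.
rewrite [RHS]mulrCA mulVKf // -mulr_sumr; congr (_ * _).
(* Along the arrival order, the sum over elements becomes a sum over positions; those before [t]
   vanish by [g0]. *)
rewrite [RHS](reindex_inj (@perm_inj _ w.1)) /=.
rewrite [RHS](bigID (fun j : 'I_n => (t <= j)%N)) /= [X in _ = _ + X]big1 ?addr0 //.
by move=> i; rewrite -ltnNge; apply: g0.
Qed.

Hypothesis q_ge0 : forall hs e B, 0 <= q hs e B.

Lemma adaptive_law_dist : is_dist adaptive_law.
Proof.
split=> [w|]; first by rewrite mulr_ge0 ?invr_ge0 ?ler0n ?prodr_ge0.
(* At [t = 0] all samples are summed out, and the total mass is a count of the [n! * #|T| ^ n]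
   outcomes. *)
have := @expect_prefix 0 (fun=> 1) (leq0n n) (fun _ _ _ _ => erefl).
rewrite /expect; under eq_bigr do rewrite mulr1.
move=> ->; under eq_bigr do rewrite mulr1 /prefix_weight big1 //.
rewrite sumr_const card_prod card_Sn card_ffun card_ord subn0 natrM natrX.
rewrite mulrACA mulVf ?mul1r ?mulVf ?expf_neq0 // pnatr_eq0 -lt0n //.
exact: fact_gt0.
Qed.

End AdaptiveSampling.

(** * Expectation and conditional expectation on finite spaces *)

Section FiniteExpectation.

Context (R : realType) (W : finType) (Pr : W -> R).
Hypothesis Pr_ge0 : forall w, 0 <= Pr w.

Lemma le_expect (X Y : W -> R) :
  (forall w, X w <= Y w) -> expect Pr X <= expect Pr Y.
Proof. by move=> leXY; apply: ler_sum => w _; apply: ler_wpM2l. Qed.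

Lemma expect_sum (I : finType) (X : I -> W -> R) :
  expect Pr (fun w => \sum_i X i w) = \sum_i expect Pr (X i).
Proof. by rewrite exchange_big; apply: eq_bigr => w _; rewrite mulr_sumr. Qed.

Lemma expectD (X Y : W -> R) :
  expect Pr (fun w => X w + Y w) = expect Pr X + expect Pr Y.
Proof. by rewrite -big_split; apply: eq_bigr => w _; rewrite mulrDr. Qed.

Lemma expectZ a (X : W -> R) : expect Pr (fun w => a * X w) = a * expect Pr X.
Proof. by rewrite mulr_sumr; apply: eq_bigr => w _; rewrite mulrCA. Qed.

Lemma expect_cst a : \sum_w Pr w = 1 -> expect Pr (fun=> a) = a.
Proof. by move=> Pr1; rewrite /expect -mulr_suml Pr1 mul1r. Qed.

Variable F : rel W.

Lemma le_cond_expect (X Y : W -> R) w :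
  (forall w', F w w' -> X w' <= Y w') ->
  cond_expect Pr F X w <= cond_expect Pr F Y w.
Proof.
move=> leXY; apply: ler_wpM2r; first by rewrite invr_ge0 sumr_ge0.
by apply: ler_sum => w' /leXY; apply: ler_wpM2l.
Qed.

Lemma cond_expectD (X Y : W -> R) w :
  cond_expect Pr F (fun w => X w + Y w) w =
  cond_expect Pr F X w + cond_expect Pr F Y w.
Proof.
rewrite -mulrDl -big_split; congr (_ / _).
by apply: eq_bigr => w' _; rewrite mulrDr.
Qed.

Lemma cond_expectZ a (X : W -> R) w :
  cond_expect Pr F (fun w => a * X w) w = a * cond_expect Pr F X w.
Proof.
rewrite mulrA mulr_sumr; congr (_ / _).
by apply: eq_bigr => w' _; rewrite mulrCA.
Qed.

Lemma cond_expect_sum (I : finType) (X : I -> W -> R) w :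
  cond_expect Pr F (fun w => \sum_i X i w) w =
  \sum_i cond_expect Pr F (X i) w.
Proof.
rewrite -mulr_suml exchange_big; congr (_ / _).
by apply: eq_bigr => w' _; rewrite mulr_sumr.
Qed.

Lemma cond_expect_cst a w :
  0 < Pr w -> F w w -> cond_expect Pr F (fun=> a) w = a.
Proof.
move=> Prw Fww; rewrite /cond_expect -mulr_suml mulrAC divff ?mul1r //.
by rewrite gt_eqF // (bigD1 w) //= ltr_pwDl ?sumr_ge0.
Qed.

Lemma measurable_cond_expect (X : W -> R) :
  equivalence_rel F -> measurable_wrt F (cond_expect Pr F X).
Proof.
move=> Feq w w' Fww'; rewrite /cond_expect.
have FE v : F w v = F w' v by have [_ ->] := Feq w w' v.
by congr (_ / _); apply: eq_bigl.
Qed.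

(** Tower property: after exchanging the sums, each [w'] collects the mass of its atom, which
    cancels the denominator. *)
Lemma expect_cond_expect (X : W -> R) :
  equivalence_rel F -> expect Pr (cond_expect Pr F X) = expect Pr X.
Proof.
move=> Feq; have Frefl w : F w w by have [] := Feq w w w.
have FE w w' v : F w w' -> F w v = F w' v.
  by move=> Fww'; have [_ ->] := Feq w w' v.
have Fsym w w' : F w w' = F w' w.
  by apply/idP/idP => Fww'; rewrite -(FE _ _ _ Fww') Frefl.
rewrite /expect /cond_expect.
under eq_bigr => w _.
  rewrite mulr_suml mulr_sumr big_mkcond.
  over.
rewrite exchange_big /=; apply: eq_bigr => w' _; rewrite -big_mkcond /=.
(* Null outcomes are set apart because their atom may have mass zero. *)
have [->|Prw'] := eqVneq (Pr w') 0.
  by rewrite mul0r big1 // => w _; rewrite !mul0r mulr0.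
have D0 : \sum_(v | F w' v) Pr v != 0.
  rewrite gt_eqF // (bigD1 w') //= ltr_pwDl ?sumr_ge0 //.
  by rewrite lt_neqAle eq_sym Prw' Pr_ge0.
transitivity (\sum_(w | F w' w)
    Pr w * (Pr w' * X w' / \sum_(v | F w' v) Pr v)).
  apply: eq_big => [w|w Fww']; first by rewrite Fsym.
  by congr (_ * (_ / _)); apply: eq_bigl => v; apply: FE.
by rewrite -mulr_suml mulrC divfK.
Qed.

End FiniteExpectation.

(** * Independent sampling of sets *)

Section IndependentSampling.

Context (R : realType) (m : nat) (x : 'I_m -> R).

Definition indep_prob (A : {set 'I_m}) : R :=
  \prod_(S < m) (if S \in A then x S else 1 - x S).

Lemma sum_indep_prob : \sum_A indep_prob A = 1.
Proof.
transitivity (\prod_(S < m) (x S + (1 - x S))).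
  by rewrite bigA_distr; apply: eq_bigl => A; rewrite inE.
by rewrite big1 // => S _; rewrite addrC subrK.
Qed.

Lemma sum_indep_prob_mem (S : 'I_m) :
  \sum_A indep_prob A * (S \in A)%:R = x S.
Proof.
(* With the exclusion factor of [S] set to zero, expanding the product of sums keeps exactly the
   families containing [S]. *)
pose y S' := if S' == S then 0 else 1 - x S'.
transitivity (\prod_(S' < m) (x S' + y S')).
  rewrite bigA_distr; apply: eq_big => A; first by rewrite inE.
  move=> _; rewrite /indep_prob; have [SA|SA] := boolP (S \in A).
    rewrite mulr1; apply: eq_bigr => S' _; case: ifP => //; rewrite /y.
    by case: eqP => // ->; rewrite SA.
  rewrite mulr0; apply/esym/eqP/prodf_eq0; exists S => //.
  by rewrite (negPf SA) /y eqxx.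
rewrite (bigD1 S) //= /y eqxx addr0 big1 ?mulr1 // => S' /negPf ->.
by rewrite addrC subrK.
Qed.

Lemma sum_indep_prob_cost (c : 'I_m -> R) :
  \sum_A indep_prob A * cost c A = \sum_S c S * x S.
Proof.
under eq_bigr do rewrite /cost big_mkcond mulr_sumr.
rewrite exchange_big; apply: eq_bigr => S _.
rewrite -[in RHS]sum_indep_prob_mem mulr_sumr; apply: eq_bigr => A _.
by case: (S \in A); rewrite ?mulr1 ?mulr0 // mulrC.
Qed.

Variable P : pred 'I_m.

Lemma sum_indep_prob_disjoint :
  \sum_A indep_prob A * (~~ [exists S in A, P S])%:R
  = \prod_(S | P S) (1 - x S).
Proof.
pose y S := if P S then 0 else x S.
transitivity (\prod_(S < m) (y S + (1 - x S))); last first.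
  rewrite [RHS]big_mkcond; apply: eq_bigr => S _; rewrite /y.
  by case: ifP => _; rewrite ?add0r // addrC subrK.
rewrite bigA_distr; apply: eq_big => A; first by rewrite inE.
move=> _; have [/exists_inP[S SA PS]|nex] := boolP [exists S in A, P S].
  rewrite mulr0; apply/esym/eqP/prodf_eq0; exists S => //.
  by rewrite SA /y PS.
rewrite mulr1; apply: eq_bigr => S _; case: ifP => // SA; rewrite /y.
by case: ifP => // PS; case/exists_inP: nex; exists S.
Qed.

Hypothesis x01 : forall S, 0 <= x S <= 1.

Lemma indep_prob_ge0 A : 0 <= indep_prob A.
Proof.
by apply: prodr_ge0 => S _; have /andP[x0 x1] := x01 S; case: ifP => _; lra.
Qed.

(** A rational substitute for bounding the product by the exponential of minus the sum; it already
    gives a constant-factor hitting probability. *)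
Lemma prod_compl_le : (\prod_(S | P S) (1 - x S)) * (1 + \sum_(S | P S) x S) <= 1.
Proof.
suff: [/\ 0 <= \prod_(S | P S) (1 - x S) <= 1, 0 <= \sum_(S | P S) x S &
    (\prod_(S | P S) (1 - x S)) * (1 + \sum_(S | P S) x S) <= 1] by case.
elim/big_rec2: _ => [|S s y _ [/andP[y0 y1] s0 ys]]; first by split; lra.
have /andP[xS0 xS1] := x01 S; have x1 : 0 <= 1 - x S by lra.
split; [apply/andP; split; nra|lra|].
have : (1 - x S) * (y * (1 + s)) <= 1 - x S by nra.
have : x S * (1 - x S) * y <= x S by have := mulr_ge0 xS0 x1; nra.
nra.
Qed.

End IndependentSampling.

(** With [s] the sum and [z = k * min 1 s], the probability of a hit is at least
    [k s / (1 + k s) >= z / (1 + z)], and [z <= 1] gives the factor 1/2. *)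
Lemma indep_hit_prob (R : realType) (m : nat) (k : R) (p : 'I_m -> R)
    (P : pred 'I_m) :
  0 <= k <= 1 -> (forall S, 0 <= p S <= 1) ->
  k * Num.min 1 (\sum_(S | P S) p S) / 2 <=
  \sum_A indep_prob (fun S => k * p S) A * [exists S in A, P S]%:R.
Proof.
move=> /andP[k0 k1] p01; set s := \sum_(S | P S) p S.
have kp01 S : 0 <= k * p S <= 1.
  by have /andP[p0 p1] := p01 S; rewrite mulr_ge0 //= mulr_ile1.
have s0 : 0 <= s by apply: sumr_ge0 => S _; case/andP: (p01 S).
have -> : \sum_A indep_prob (fun S => k * p S) A * [exists S in A, P S]%:R
    = 1 - \prod_(S | P S) (1 - k * p S).
  rewrite -(sum_indep_prob_disjoint _ P) -[X in X - _](sum_indep_prob (fun S => k * p S)).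
  rewrite -sumrB; apply: eq_bigr => A _.
  by case: [exists S in A, P S]; rewrite ?mulr1 ?mulr0 ?subr0 ?subrr.
have := prod_compl_le P kp01; rewrite -mulr_sumr -/s.
set y := \prod_(S | _) _ => ys.
have y0 : 0 <= y.
  by apply: prodr_ge0 => S _; have /andP[kp0 kp1] := kp01 S; lra.
have ks0 := mulr_ge0 k0 s0.
have min0 : 0 <= Num.min 1 s by rewrite le_min ler01.
have min1 : Num.min 1 s <= 1 by rewrite ge_min lexx.
have mins : Num.min 1 s <= s by rewrite ge_min lexx orbT.
have kmin1 : k * Num.min 1 s <= 1 by rewrite mulr_ile1.
have kmins : k * Num.min 1 s <= k * s by rewrite ler_wpM2l.
nra.
Qed.

(** This is [ln (1 + x) <= x] at [x = b / a - 1]; it turns relative drops into telescoping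
    differences. *)
Lemma ln_drop (R : realType) (a b : R) :
  0 < a -> 0 < b -> (a - b) / a <= ln a - ln b.
Proof.
move=> a0 b0; have /le_ln1Dx : -1 < b / a - 1 by rewrite ltrBrDl subrr divr_gt0.
rewrite addrC subrK ln_div ?posrE // mulrBl divff ?gt_eqF //; lra.
Qed.

(** * One step of the algorithm: costs, potential and sampling *)

Section CoverSteps.

Context (R : realType) (n m : nat) (sets : 'I_m -> {set 'I_n}) (c : 'I_m -> R)
  (Est : R) (cheapest : 'I_n -> 'I_m)
  (subgrad : R -> 'I_n -> 'rV[R]_m -> 'rV[R]_m)
  (oco : seq 'rV[R]_m -> 'rV[R]_m).

Notation kappa := (cur_kappa sets c cheapest).
Notation next := (step sets c cheapest subgrad oco).
Notation sampling := (sample_prob sets c Est cheapest oco).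

Hypothesis c_ge0 : forall S, 0 <= c S.
Hypothesis cheapestP : cheapest_rule sets c cheapest.

Lemma le_cost_sum (A B D : {set 'I_m}) :
  A \subset B :|: D -> cost c A <= cost c B + cost c D.
Proof.
move=> sABD; rewrite /cost ![\sum_(_ in _) _]big_mkcond -big_split /=.
apply: ler_sum => S _; have /subsetP/(_ S) := sABD; rewrite inE.
have := c_ge0 S; case: (S \in A) => /=.
  by move=> cS /(_ isT); case: (S \in B); case: (S \in D) => //= _; lra.
by move=> cS _; case: (S \in B); case: (S \in D) => /=; lra.
Qed.

Lemma coveredU (A B : {set 'I_m}) e :
  covered sets (A :|: B) e = covered sets A e || covered sets B e.
Proof.
apply/exists_inP/orP => [[S]|].
  by rewrite inE => /orP[SA|SB] eS; [left|right]; apply/exists_inP; exists S.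
by case=> /exists_inP[S SA eS]; exists S => //; rewrite inE SA ?orbT.
Qed.

Lemma kappa_ge0 st e : 0 <= kappa st e.
Proof. by rewrite /cur_kappa; case: ifP. Qed.

Lemma kappa_le_set st e S : e \in sets S -> kappa st e <= c S.
Proof.
by move=> eS; rewrite /cur_kappa; case: ifP => // _; case: (cheapestP e) => _; apply.
Qed.

Lemma kappa_next_le st eA e : kappa (next st eA) e <= kappa st e.
Proof.
case: eA => f A; rewrite /cur_kappa /= !coveredU.
by case: ifP => [_|/negbT]; [case: ifP | rewrite !negb_or => /andP[/andP[/negPf-> _] _]].
Qed.

Lemma kappa_next_covered st e A f :
  covered sets A f -> kappa (next st (e, A)) f = 0.
Proof. by move=> Af; rewrite /cur_kappa /= !coveredU Af !orbT. Qed.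

Lemma kappa_next_arrived st e A : kappa (next st (e, A)) e = 0.
Proof.
rewrite /cur_kappa /= !coveredU; case: (covered sets (bought st) e) => //=.
case: ifP => // /norP[/negP[]].
by apply/exists_inP; exists (cheapest e); rewrite ?set11; case: (cheapestP e).
Qed.

Lemma cost_next st e A :
  cost c (bought (next st (e, A))) <=
  cost c (bought st) + (kappa st e + cost c A).
Proof.
rewrite addrA; apply: (le_trans (le_cost_sum (subxx _))); rewrite lerD2r.
apply: (le_trans (le_cost_sum (subxx _))); rewrite lerD2l /cur_kappa.
by case: ifP => _; rewrite /cost ?big_set0 ?big_set1.
Qed.

Definition potential st : R := \sum_e kappa st e.

Lemma potential_ge0 st : 0 <= potential st.
Proof. by apply: sumr_ge0 => e _; apply: kappa_ge0. Qed.

Lemma potential_drop_arrived st e A :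
  kappa st e <= potential st - potential (next st (e, A)).
Proof.
rewrite -sumrB (bigD1 e) // kappa_next_arrived subr0 ler_wpDr //.
by apply: sumr_ge0 => f _; rewrite subr_ge0 kappa_next_le.
Qed.

Lemma potential_drop_sampled st e A :
  \sum_f kappa st f * (covered sets A f)%:R <=
  potential st - potential (next st (e, A)).
Proof.
rewrite -sumrB; apply: ler_sum => f _; have [Af|_] := boolP (covered sets A f).
  by rewrite mulr1 kappa_next_covered // subr0.
by rewrite mulr0 subr_ge0 kappa_next_le.
Qed.

Hypothesis kappa_le : forall e, c (cheapest e) <= Est.
Hypothesis ocoP : forall gs, Pbar c Est (oco gs).

Lemma kappa_le_Est st e : kappa st e <= Est.
Proof.
rewrite /cur_kappa; case: ifP => // _.
exact: le_trans (c_ge0 _) (kappa_le e).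
Qed.

Lemma rate01 st e : 0 <= kappa st e / Est <= 1.
Proof.
have k0 := kappa_ge0 st e; have kE := kappa_le_Est st e.
(* Division by zero returns zero, so the rate is zero when [Est = 0]. *)
have [->|E0] := eqVneq Est 0; first by rewrite invr0 mulr0 lexx ler01.
have Egt0 : 0 < Est by rewrite lt_neqAle eq_sym E0 (le_trans k0 kE).
by rewrite divr_ge0 ?(ltW Egt0) //= ler_pdivrMr // mul1r.
Qed.

Lemma incl_prob01 st e S : 0 <= incl_prob sets c Est cheapest oco st e S <= 1.
Proof.
have /andP[r0 r1] := rate01 st e; have [p01 _] := ocoP (fed st).
by have /andP[p0 p1] := p01 S; rewrite mulr_ge0 //= mulr_ile1.
Qed.

Lemma sampling_ge0 st e A : 0 <= sampling st e A.
Proof. by apply: indep_prob_ge0 => S; apply: incl_prob01. Qed.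

Lemma sum_sampling st e : \sum_A sampling st e A = 1.
Proof. exact: sum_indep_prob. Qed.

(** The budget constraint of [Pbar] cancels the [Est] dividing the sampling rate. *)
Lemma sampling_cost_le st e : \sum_A sampling st e A * cost c A <= kappa st e.
Proof.
rewrite [leLHS](sum_indep_prob_cost (incl_prob sets c Est cheapest oco st e)).
have [_ cp] := ocoP (fed st); have /andP[r0 r1] := rate01 st e.
rewrite /incl_prob; under eq_bigr do rewrite mulrCA; rewrite -mulr_sumr.
apply: (le_trans (ler_wpM2l r0 cp)).
have [->|E0] := eqVneq Est 0; first by rewrite mulr0 kappa_ge0.
by rewrite divfK.
Qed.

(** The factor of the gain at [f] that does not involve its cost. *)
Definition fractional_cover st (f : 'I_n) : R :=
  Num.min 1 (\sum_(S < m | f \in sets S) cur_p oco st 0 S).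

Lemma fractional_cover01 st f : 0 <= fractional_cover st f <= 1.
Proof.
rewrite le_min ler01 ge_min lexx /= andbT; apply: sumr_ge0 => S _.
by have [p01 _] := ocoP (fed st); case/andP: (p01 S).
Qed.

Lemma sampling_covers st e f :
  kappa st e / Est * fractional_cover st f / 2 <=
  \sum_A sampling st e A * (covered sets A f)%:R.
Proof.
by have [p01 _] := ocoP (fed st); apply: indep_hit_prob p01; apply: rate01.
Qed.

(* The drop is bounded below both by the cost of the arriving element and by
   what the sampled sets cover; this is the average of the two bounds. *)
Lemma potential_drop st e :
  kappa st e *
    ((\sum_f kappa st f * fractional_cover st f) / Est / 2 + 1) / 2 <=
  \sum_A sampling st e A * (potential st - potential (next st (e, A))).
Proof.
set drop := (X in _ <= X).
have drop1 : kappa st e <= drop.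
  rewrite -[leLHS]mul1r -(sum_sampling st e) mulr_suml.
  apply: ler_sum => A _; apply: ler_wpM2l; first exact: sampling_ge0.
  exact: potential_drop_arrived.
suff drop2 : kappa st e *
    ((\sum_f kappa st f * fractional_cover st f) / Est / 2) <= drop by lra.
apply: (@le_trans _ _
    (\sum_A sampling st e A * \sum_f kappa st f * (covered sets A f)%:R)).
  under [leRHS]eq_bigr do rewrite mulr_sumr.
  rewrite exchange_big /= !mulr_suml mulr_sumr; apply: ler_sum => f _.
  have := ler_wpM2l (kappa_ge0 st f) (sampling_covers st e f).
  rewrite mulr_sumr; under eq_bigr do rewrite mulrCA.
  by apply: le_trans; rewrite le_eqVlt; apply/orP; left; apply/eqP; ring.
apply: ler_sum => A _; apply: ler_wpM2l; first exact: sampling_ge0.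
exact: potential_drop_sampled.
Qed.

(** * Runs of the algorithm as an adaptive process *)

Notation run := (state_after sets c cheapest subgrad oco).
Notation Pr := (law sets c Est cheapest subgrad oco).
Implicit Types (w : outcome n m) (t : nat).

Notation state_of := (foldl next (init R m)).

(** Since the state is a function of the history, [law] is an instance of [adaptive_law]. *)
Lemma run_history w t : run w t = state_of (history w t).
Proof. by []. Qed.

Lemma run_next w (t : 'I_n) : run w t.+1 = next (run w t) (w.1 t, w.2 t).
Proof. by rewrite !run_history history_rcons -cats1 foldl_cat. Qed.

Lemma subfamilies_gt0 : (0 < #|{set 'I_m}|)%N.
Proof. by apply/card_gt0P; exists set0. Qed.

Lemma law_dist : is_dist Pr.
Proof.
apply: (adaptive_law_dist (q := fun hs => sampling (state_of hs))) subfamilies_gt0 _.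
  by move=> hs e; apply: sum_sampling.
by move=> hs e B; apply: sampling_ge0.
Qed.

Lemma law_sample (t : 'I_n) (g : state R m -> 'I_n -> {set 'I_m} -> R) :
  expect Pr (fun w => g (run w t) (w.1 t) (w.2 t)) =
  expect Pr (fun w => \sum_A sampling (run w t) (w.1 t) A
                             * g (run w t) (w.1 t) A).
Proof.
apply: (expect_sample (q := fun hs => sampling (state_of hs)) _ subfamilies_gt0 t
  (fun hs => g (state_of hs))).
by move=> hs e; apply: sum_sampling.
Qed.

(** An element is covered once it has arrived, and [kappa] never increases afterwards. *)
Lemma kappa_arrived w t (i : 'I_n) : (i < t)%N -> kappa (run w t) (w.1 i) = 0.
Proof.
elim: t => // t IH; rewrite ltnS => le_it.
have [lt_tn|le_nt] := ltnP t n; last first.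
  have -> : run w t.+1 = run w t.
    by rewrite !run_history !history_oversize // leqW.
  by apply: IH; rewrite (leq_trans (ltn_ord i)).
rewrite (run_next w (Ordinal lt_tn)); have [<-|neq_it] := eqVneq i (Ordinal lt_tn).
  exact: kappa_next_arrived.
apply/eqP; rewrite eq_le kappa_ge0 andbT -(IH _) ?kappa_next_le //.
by rewrite ltn_neqAle le_it andbT; move: neq_it; rewrite -val_eqE.
Qed.

(** The factor [kappa] kills the elements already seen, so the average over the [n - t] remaining
    ones can be written as a sum over all elements. *)
Lemma law_arrival (t : 'I_n) (g : state R m -> 'I_n -> R) :
  expect Pr (fun w => kappa (run w t) (w.1 t) * g (run w t) (w.1 t)) =
  expect Pr (fun w => (n - t)%:R^-1 *
                      \sum_e kappa (run w t) e * g (run w t) e).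
Proof.
apply: (expect_arrival (q := fun hs => sampling (state_of hs)) _ subfamilies_gt0
  (g := fun hs e => kappa (state_of hs) e * g (state_of hs) e)).
  by move=> hs e; apply: sum_sampling.
by move=> w i lt_it; rewrite -run_history kappa_arrived // mul0r.
Qed.

(** * Expected cost and the logarithmic bound on the total gain *)

Lemma alg_cost_le w :
  alg_cost sets c cheapest subgrad oco w <=
  \sum_(t < n) (kappa (run w t) (w.1 t) + cost c (w.2 t)).
Proof.
rewrite /alg_cost.
suff H t : (t <= n)%N -> cost c (bought (run w t)) <=
    \sum_(s < n | (s < t)%N) (kappa (run w s) (w.1 s) + cost c (w.2 s)).
  apply: le_trans (H n (leqnn n)) _; rewrite le_eqVlt; apply/orP; left; apply/eqP.
  by apply: eq_bigl => i; rewrite ltn_ord.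
elim: t => [|t IH] le_tn.
  by rewrite big_pred0 // run_history /history take0 /cost big_set0.
rewrite (run_next w (Ordinal le_tn)) (le_trans (cost_next _ _ _)) //.
rewrite (bigD1 (Ordinal le_tn)) //= [leRHS]addrC lerD2r (le_trans (IH (ltnW le_tn))) //.
by rewrite le_eqVlt; apply/orP; left; apply/eqP; apply: eq_bigl => i;
  rewrite ltnS ltn_neqAle andbC -val_eqE.
Qed.

Lemma expected_cost_le :
  expected_alg_cost sets c Est cheapest subgrad oco <=
  2 * \sum_(t < n) expect Pr (fun w => kappa (run w t) (w.1 t)).
Proof.
have [Pr0 Pr1] := law_dist.
apply: (le_trans (le_expect Pr0 alg_cost_le)).
rewrite expect_sum mulr_sumr; apply: ler_sum => t _.
rewrite expectD mulr_natl mulr2n lerD2l (law_sample t (fun _ _ => cost c)).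
by apply: (le_expect Pr0) => w; apply: sampling_cost_le.
Qed.

Lemma expected_gain_le (t : 'I_n) :
  0 < Est ->
  expect Pr (fun w => gain sets Est (kappa (run w t) (w.1 t)) (w.1 t)
                        (cur_p oco (run w t))) <=
  4 * expect Pr (fun w => (potential (run w t) - potential (run w t.+1))
                           / (Est + potential (run w t))).
Proof.
move=> E0; have [Pr0 _] := law_dist.
(* [M st / Est] is the gain summed over all elements. Below, [g1] and [g2] exhibit the two
   integrands as [kappa] times a factor, the form in which the arriving element can be averaged
   out. *)
pose M st := \sum_f kappa st f * fractional_cover st f.
pose g1 st f := Est^-1 * fractional_cover st f.
have -> : expect Pr (fun w => gain sets Est (kappa (run w t) (w.1 t)) (w.1 t)
      (cur_p oco (run w t))) =
    expect Pr (fun w => (n - t)%:R^-1 * (M (run w t) / Est)).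
  transitivity (expect Pr (fun w => kappa (run w t) (w.1 t)
      * g1 (run w t) (w.1 t))).
    by apply: eq_bigr => w _; congr (_ * _); rewrite /gain /g1 mulrA.
  rewrite law_arrival; apply: eq_bigr => w _; congr (_ * (_ * _)).
  by rewrite /M mulr_suml; apply: eq_bigr => f _; rewrite /g1 mulrCA mulrC.
have -> : expect Pr (fun w => (potential (run w t) - potential (run w t.+1))
      / (Est + potential (run w t))) =
    expect Pr (fun w => \sum_A sampling (run w t) (w.1 t) A *
      ((potential (run w t) - potential (next (run w t) (w.1 t, A)))
        / (Est + potential (run w t)))).
  rewrite -(law_sample t (fun st e A =>
    (potential st - potential (next st (e, A))) / (Est + potential st))).
  by apply: eq_bigr => w _; rewrite run_next.
pose g2 st (e : 'I_n) := (M st / Est / 2 + 1) / 2 / (Est + potential st).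
apply: (@le_trans _ _ (4 * expect Pr (fun w =>
    kappa (run w t) (w.1 t) * g2 (run w t) (w.1 t)))); last first.
  rewrite ler_pM2l //; apply: (le_expect Pr0) => w.
  have EP : 0 < Est + potential (run w t) by rewrite ltr_pwDl ?potential_ge0.
  under eq_bigr do rewrite mulrA; rewrite -mulr_suml /g2 !mulrA.
  rewrite ler_pM2r ?invr_gt0 //.
  exact: potential_drop.
rewrite law_arrival -expectZ; apply: (le_expect Pr0) => w.
rewrite [leRHS]mulrCA ler_wpM2l ?invr_ge0 ?ler0n // /g2 -mulr_suml -/(potential _).
set st := run w t; have P0 := potential_ge0 st.
have EP : 0 < Est + potential st by rewrite ltr_pwDl.
have MP : M st <= potential st.
  apply: ler_sum => f _; have /andP[f0 f1] := fractional_cover01 st f.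
  by rewrite ler_piMr ?kappa_ge0.
(* The 4 undoes two halvings, one from the hitting probability and one from averaging the two drops.
   After clearing [Est + potential st], the claim reduces to [M st <= 2 * potential st]. *)
have -> : 4 * (potential st * ((M st / Est / 2 + 1) / 2 / (Est + potential st)))
    = (potential st * (M st / Est) + 2 * potential st) / (Est + potential st).
  by field; rewrite gt_eqF // gt_eqF.
rewrite ler_pdivlMr // mulrDr divfK ?gt_eqF // [_ * potential st]mulrC; lra.
Qed.

Lemma expected_gain_sum_le :
  0 < Est ->
  \sum_(t < n)
    expect Pr (fun w => gain sets Est (kappa (run w t) (w.1 t)) (w.1 t)
                        (cur_p oco (run w t))) <=
  4 * ln (1 + n%:R).
Proof.
move=> E0; have [Pr0 Pr1] := law_dist.
apply: le_trans; first by apply: ler_sum => t _; apply: expected_gain_le E0.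
rewrite -mulr_sumr ler_pM2l // -expect_sum -(expect_cst (ln _) Pr1).
apply: (le_expect Pr0) => w.
(* Along each run the drops of [u] telescope; [u n >= ln Est], while [u 0 <= ln ((1 + n) Est)] since
   each [kappa] is at most [Est]. *)
pose u t := ln (Est + potential (run w t)).
have EP t : 0 < Est + potential (run w t) by rewrite ltr_pwDl ?potential_ge0.
apply: (@le_trans _ _ (\sum_(t < n) (u t - u t.+1))).
  apply: ler_sum => t _; apply: le_trans (ln_drop (EP t) (EP t.+1)).
  by rewrite opprD addrACA subrr add0r.
rewrite -(big_mkord xpredT (fun t => u t - u t.+1)) -[leLHS]opprK -sumrN.
under eq_bigr do rewrite opprB.
rewrite telescope_sumr // opprB lerBlDr.
have le_un : ln Est <= u n.
  by rewrite ler_ln ?posrE ?EP // lerDl potential_ge0.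
have n1 : 0 < 1 + n%:R :> R by rewrite ltr_pwDl ?ler0n.
suff: u 0%N <= ln ((1 + n%:R) * Est) by rewrite lnM ?posrE //; lra.
rewrite ler_ln ?posrE ?EP ?mulr_gt0 // mulrDl mul1r lerD2l.
rewrite -[n in n%:R]card_ord mulr_natl -sumr_const.
by apply: ler_sum => e _; apply: kappa_le_Est.
Qed.

(** * The gains as an admissible feed for the online learner *)

Lemma gain_concave k e :
  0 <= k / Est -> concave_on (Pbar c Est) (gain sets Est k e).
Proof.
move=> r0 p q l _ _ /andP[l0 l1]; rewrite /gain mulrCA [X in _ + X]mulrCA -mulrDr.
apply: ler_wpM2l => //.
have -> : \sum_(S | e \in sets S) (l *: p + (1 - l) *: q) 0 S =
    l * (\sum_(S | e \in sets S) p 0 S) +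
    (1 - l) * (\sum_(S | e \in sets S) q 0 S).
  by rewrite !mulr_sumr -big_split; apply: eq_bigr => S _; rewrite !mxE.
set a := \sum_(S | _) p 0 S; set b := \sum_(S | _) q 0 S.
have a1 : Num.min 1 a <= 1 by rewrite ge_min lexx.
have aa : Num.min 1 a <= a by rewrite ge_min lexx orbT.
have b1 : Num.min 1 b <= 1 by rewrite ge_min lexx.
have bb : Num.min 1 b <= b by rewrite ge_min lexx orbT.
by rewrite le_min; apply/andP; split; nra.
Qed.

Lemma gain_ge0 k e p : 0 <= k / Est -> Pbar c Est p -> 0 <= gain sets Est k e p.
Proof.
move=> r0 [p01 _]; rewrite mulr_ge0 // le_min ler01 sumr_ge0 // => S _.
by case/andP: (p01 S).
Qed.

Lemma sum_shift (e : 'I_n) (p : 'rV[R]_m) a (S : 'I_m) :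
  \sum_(S' | e \in sets S') (p + a *: delta_mx 0 S) 0 S' =
  \sum_(S' | e \in sets S') p 0 S' + a * (e \in sets S)%:R.
Proof.
under eq_bigr do rewrite !mxE eqxx /=.
rewrite big_split -mulr_sumr; congr (_ + _ * _).
rewrite big_mkcond (bigD1 S) //= eqxx big1 ?addr0; first by case: ifP.
by move=> S' /negPf->; case: ifP.
Qed.

Hypothesis subgradP : subgradient_rule sets c Est subgrad.

(* Monotonicity of the gain in coordinate [S] gives the lower bound, and its
   Lipschitz constant in that coordinate the upper one. *)
Lemma subgrad_bounds k e p S :
  0 < Est -> 0 <= k -> (forall S, e \in sets S -> k <= c S) -> Pbar c Est p ->
  0 <= subgrad k e p 0 S <= c S / Est.
Proof.
move=> E0 k0 kc Pp; have r0 : 0 <= k / Est by rewrite divr_ge0 ?(ltW E0).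
have dotpE a : dotp (subgrad k e p) (p + a *: delta_mx 0 S - p)
    = a * subgrad k e p 0 S.
  rewrite addrC addKr /dotp (bigD1 S) //= !mxE !eqxx mulr1 mulrC big1 ?addr0 //.
  by move=> S' /negPf nS; rewrite !mxE nS andbF !mulr0.
have sub a : gain sets Est k e (p + a *: delta_mx 0 S) <=
    gain sets Est k e p + a * subgrad k e p 0 S.
  by rewrite -dotpE; apply: subgradP.
(* Unit shifts up and down in coordinate [S] may leave [Pbar]; they are legitimate because
   subgradients are taken on the whole space. *)
have := sub 1; have := sub (-1); rewrite /gain !sum_shift !mul1r !mulN1r.
set s := \sum_(S' | _) _; set g := subgrad k e p 0 S.
have [eS|eS] := boolP (e \in sets S); rewrite /= ?oppr0 ?addr0; last first.
  move=> h1 h2; have cE : 0 <= c S / Est by rewrite divr_ge0 ?(ltW E0).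
  by apply/andP; split; lra.
have min1 : Num.min 1 s <= Num.min 1 (s + 1).
  by rewrite le_min ge_min lexx /= ge_min lerDl ler01 orbT.
have min2 : Num.min 1 s - 1 <= Num.min 1 (s - 1).
  have m1 : Num.min 1 s <= 1 by rewrite ge_min lexx.
  have ms : Num.min 1 s <= s by rewrite ge_min lexx orbT.
  by rewrite le_min; apply/andP; split; lra.
have := ler_wpM2l r0 min1; have := ler_wpM2l r0 min2; rewrite mulrBr mulr1.
have : k / Est <= c S / Est by rewrite ler_pM2r ?invr_gt0 ?kc.
by move=> h1 h2 h3 h4 h5; apply/andP; split; lra.
Qed.

Definition known t : rel (outcome n m) :=
  fun w w' => history w t == history w' t.

Lemma known_equiv t : equivalence_rel (known t).
Proof. by move=> w w' w''; split=> [|/eqP]; rewrite /known ?eqxx // => ->. Qed.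

Lemma known_le s t : (s <= t)%N -> subrel (known t) (known s).
Proof.
move=> le_st w w' /eqP e; apply/eqP.
by have := congr1 (take s) e; rewrite /history !take_takel.
Qed.

Lemma known_filtration : filtration known.
Proof.
by split=> t; [apply: known_equiv|apply: known_le].
Qed.

Lemma known_run t w w' : known t w w' -> run w t = run w' t.
Proof. by move=> /eqP e; rewrite !run_history e. Qed.

(** Feeds are indexed by all of [nat]; from time [n] on, gain and gradient default to zero. *)
Definition arrival_gain t w (p : 'rV[R]_m) : R :=
  oapp (fun i : 'I_n => gain sets Est (kappa (run w t) (w.1 i)) (w.1 i) p)
    0 (insub t).

Definition fed_gradient t w : 'rV[R]_m :=
  oapp (fun i : 'I_n => subgrad (kappa (run w t) (w.1 i)) (w.1 i)
                          (cur_p oco (run w t))) 0 (insub t).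

(** The gain at time [t] depends on the element about to arrive, so it is not known before the step;
    its conditional expectation is, and serves as the function fed to the learner. *)
Definition mean_gain t w (p : 'rV[R]_m) : R :=
  cond_expect Pr (known t) (fun w' => arrival_gain t w' p) w.

Lemma fed_run w t : (t <= n)%N -> fed (run w t) = mkseq (fed_gradient^~ w) t.
Proof.
elim: t => [|t IH] lt_tn; first by rewrite run_history /history take0.
rewrite (run_next w (Ordinal lt_tn)) /= IH 1?ltnW // mkseqS.
by rewrite /fed_gradient insubT.
Qed.

Lemma iterate_run t w :
  (t <= n)%N -> iterate oco fed_gradient t w = cur_p oco (run w t).
Proof. by move=> le_tn; rewrite /iterate -fed_run. Qed.

Lemma measurable_fed_gradient t : measurable_wrt (known t.+1) (fed_gradient t).
Proof.
move=> w w' Fww'; rewrite /fed_gradient; case: insubP => [i _ ti|//] /=.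
have /known_run-> : known t w w' by apply: known_le Fww'.
by move: Fww'; rewrite /known -ti !history_rcons => /eqP/rcons_inj[_ -> _].
Qed.

Lemma iterate_known t :
  measurable_wrt (known t) (iterate oco fed_gradient t).
Proof.
move=> w w' Fww'; congr (oco _); apply/eq_in_map => s.
rewrite mem_iota add0n => /andP[_ lt_st].
by apply: measurable_fed_gradient; apply: known_le Fww'.
Qed.

Lemma arrival_gain_subgradient t w p :
  Pbar c Est p ->
  arrival_gain t w p <=
  arrival_gain t w (iterate oco fed_gradient t w)
  + dotp (fed_gradient t w) (p - iterate oco fed_gradient t w).
Proof.
move=> Pp; rewrite /arrival_gain {2}/fed_gradient; case: insubP => [i _ ti|_] /=.
  rewrite iterate_run; last by rewrite -ti ltnW ?ltn_ord.
  exact: (subgradP _ (kappa_ge0 _ _) (ocoP _) I).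
by rewrite add0r /dotp big1 // => S _; rewrite mxE mul0r.
Qed.

(** Iterates are constant on the atoms of [known t], so conditioning the subgradient inequality of
    the realised gain yields that of the mean gain. *)
Lemma arrival_feed_admissible :
  0 < Est -> admissible_feed c Est oco Pr known mean_gain fed_gradient.
Proof.
move=> E0; have [Pr0 _] := law_dist.
have rate0 st e : 0 <= kappa st e / Est by case/andP: (rate01 st e).
split.
- by move=> t p; apply: measurable_cond_expect (known_equiv t).
- exact: measurable_fed_gradient.
- move=> t w Prw; have Fww : known t w w by rewrite /known eqxx.
  split=> [p Pp|p q l Pp Pq l01].
    rewrite -(cond_expect_cst Pr0 0 Prw Fww); apply: le_cond_expect => // w' _.
    rewrite /arrival_gain; case: insubP => [i _ _|//] /=.
    exact: gain_ge0.
  rewrite /mean_gain -!cond_expectZ -cond_expectD; apply: le_cond_expect => // w' _.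
  rewrite /arrival_gain; case: insubP => [i _ _|_] /=.
    exact: gain_concave Pp Pq l01.
  by rewrite !mulr0 addr0.
- move=> t w S _; rewrite /fed_gradient; case: insubP => [i _ _|_] /=.
    apply: subgrad_bounds; rewrite ?kappa_ge0 //; last exact: ocoP.
    by move=> S'; apply: kappa_le_set.
  by rewrite mxE lexx divr_ge0 ?(ltW E0).
move=> t w Prw p Pp.
set x := iterate oco fed_gradient t w.
have -> : dotp (\row_S cond_expect Pr (known t)
      (fun w' => fed_gradient t w' 0 S) w) (p - x) =
    cond_expect Pr (known t)
      (fun w' => \sum_S (p - x) 0 S * fed_gradient t w' 0 S) w.
  rewrite cond_expect_sum; apply: eq_bigr => S _.
  by rewrite cond_expectZ mxE mulrC.
rewrite -cond_expectD; apply: le_cond_expect => // w' Fww'.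
have -> : x = iterate oco fed_gradient t w' by apply: iterate_known Fww'.
rewrite (eq_bigr (fun S => fed_gradient t w' 0 S *
  (p - iterate oco fed_gradient t w') 0 S)).
  exact: arrival_gain_subgradient.
by move=> S _; rewrite mulrC.
Qed.

Lemma arrival_gain_ord (t : 'I_n) w p :
  arrival_gain t w p = gain sets Est (kappa (run w t) (w.1 t)) (w.1 t) p.
Proof. by rewrite /arrival_gain valK. Qed.

(** * From the regret guarantee to the cost bound *)

Lemma omd_regret K p :
  0 < Est -> omd_guarantee c Est K oco -> Pbar c Est p ->
  (forall e, 1 <= \sum_(S | e \in sets S) p 0 S) ->
  2^-1 * ((\sum_(t < n) expect Pr (fun w => kappa (run w t) (w.1 t))) / Est)
    - K * (1 + ln m%:R) <=
  \sum_(t < n)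
    expect Pr (fun w => gain sets Est (kappa (run w t) (w.1 t)) (w.1 t)
                          (cur_p oco (run w t))).
Proof.
move=> E0 [_ omd] Pp p1; have [Pr0 Pr1] := law_dist.
(* The stopping time is the constant [n]. Since [p] covers every element fractionally, its gain at
   each step is the full [kappa / Est]. *)
have := omd _ Pr known mean_gain fed_gradient (fun=> n) p law_dist
  known_filtration (fun t w w' _ => erefl) (arrival_feed_admissible E0) Pp.
rewrite !expect_sum.
have -> : \sum_(t < n) expect Pr (fun w => mean_gain t w p) =
    (\sum_(t < n) expect Pr (fun w => kappa (run w t) (w.1 t))) / Est.
  rewrite mulr_suml; apply: eq_bigr => t _.
  rewrite (expect_cond_expect Pr0 _ (known_equiv t)) mulrC -expectZ.
  apply: eq_bigr => w _; rewrite arrival_gain_ord /gain.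
  by rewrite (min_idPl (p1 _)) mulr1 [Est^-1 * _]mulrC.
move=> h; apply: le_trans h _; apply: ler_sum => t _.
rewrite -(expect_cond_expect Pr0 (fun w => gain _ _ _ _ _) (known_equiv t)).
apply: (le_expect Pr0) => w; apply: le_cond_expect => // w' Fww'.
by rewrite arrival_gain_ord iterate_run 1?ltnW // (known_run Fww').
Qed.

(** The leading 4 combines the 2 from paying for fallback and sampled sets with the 2 from the
    halved comparator in the guarantee. *)
Lemma expected_cost_bound K p :
  0 < Est -> omd_guarantee c Est K oco -> Pbar c Est p ->
  (forall e, 1 <= \sum_(S | e \in sets S) p 0 S) ->
  expected_alg_cost sets c Est cheapest subgrad oco <=
  4 * (K * (1 + ln m%:R) + 4 * ln (1 + n%:R)) * Est.
Proof.
move=> E0 omd Pp p1.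
have hr := omd_regret E0 omd Pp p1; have hg := expected_gain_sum_le E0.
apply: le_trans expected_cost_le _.
rewrite -ler_pdivrMr // -mulrA; lra.
Qed.

Lemma expected_cost_le0 :
  Est <= 0 -> expected_alg_cost sets c Est cheapest subgrad oco <= 0.
Proof.
move=> E0; apply: (le_trans expected_cost_le); have [Pr0 Pr1] := law_dist.
rewrite pmulr_rle0 //; apply: sumr_le0 => t _; rewrite -(expect_cst 0 Pr1).
by apply: (le_expect Pr0) => w; apply: le_trans (kappa_le_Est _ _) E0.
Qed.

End CoverSteps.

(** * Comparison with the optimum and the final constant *)

Lemma opt_cover (R : realType) (n m : nat) (sets : 'I_m -> {set 'I_n})
    (c : 'I_m -> R) :
  is_cover sets [set: 'I_m] ->
  exists2 A : {set 'I_m}, is_cover sets A & cost c A = opt sets c.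
Proof. by move=> cov; rewrite /opt; case: arg_minP => // A covA _; exists A. Qed.

Lemma cheapest_le_opt (R : realType) (n m : nat) (sets : 'I_m -> {set 'I_n})
    (c : 'I_m -> R) (cheapest : 'I_n -> 'I_m) e :
  (forall S, 0 <= c S) -> is_cover sets [set: 'I_m] ->
  cheapest_rule sets c cheapest -> c (cheapest e) <= opt sets c.
Proof.
move=> c0 cov cheap; have [A /forallP/(_ e)/exists_inP[S SA eS] <-] := opt_cover c cov.
rewrite /cost (bigD1 S) //= (le_trans ((cheap e).2 S eS)) // lerDl.
exact: sumr_ge0.
Qed.

Lemma opt_fractional (R : realType) (n m : nat) (sets : 'I_m -> {set 'I_n})
    (c : 'I_m -> R) (Est : R) :
  is_cover sets [set: 'I_m] -> opt sets c <= Est ->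
  exists2 p : 'rV[R]_m, Pbar c Est p &
    forall e, 1 <= \sum_(S | e \in sets S) p 0 S.
Proof.
move=> cov leE; have [A covA costA] := opt_cover c cov.
(* The comparator is the indicator vector of an optimal cover. *)
exists (\row_S (S \in A)%:R); first split.
- by move=> S; rewrite mxE; case: (S \in A); rewrite ?lexx ler01.
- rewrite (le_trans _ leE) // -costA /cost [leRHS]big_mkcond.
  by apply: ler_sum => S _; rewrite mxE; case: (S \in A); rewrite ?mulr1 ?mulr0.
move=> e; have /forallP/(_ e)/exists_inP[S SA eS] := covA.
rewrite (bigD1 S) //= mxE SA lerDl; apply: sumr_ge0 => S' _.
by rewrite mxE ler0n.
Qed.

(** For [N = m * n >= 2] one has [ln N >= ln 2 >= 1/2], the latter by [ln_drop] at 2 and 1, and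
    [1 + n <= N ^ 2]. *)
Lemma ln_bounds (R : realType) (n m : nat) : (1 < m * n)%N ->
  [/\ 1 <= 2 * ln (m * n)%:R :> R, ln m%:R <= ln (m * n)%:R :> R &
      ln (1 + n%:R) <= 2 * ln (m * n)%:R :> R].
Proof.
move=> mn1; have mn0 := ltnW mn1.
have [m0 n0] : (0 < m)%N /\ (0 < n)%N by move: mn0; rewrite muln_gt0 => /andP.
have mnR : 2 <= (m * n)%:R :> R by rewrite ler_nat.
have mngt : 0 < (m * n)%:R :> R by rewrite ltr0n.
split.
- have := @ln_drop R 2 1 (ltr0Sn _ _) ltr01; rewrite ln1.
  have : ln 2 <= ln (m * n)%:R :> R by rewrite ler_ln ?posrE.
  by lra.
- by rewrite ler_ln ?posrE ?ltr0n // ler_nat leq_pmulr.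
rewrite mulr2n mulrDl mul1r -lnM ?posrE // ler_ln ?posrE ?mulr_gt0 //; last first.
  by rewrite ltr_pwDl ?ler0n.
have : n%:R <= (m * n)%:R :> R by rewrite ler_nat leq_pmull.
by nra.
Qed.

Theorem theorem3p1 (R : realType) (K : R) :
  exists C : R,
    forall (n m : nat) (sets : 'I_m -> {set 'I_n}) (c : 'I_m -> R) (Est : R)
      (cheapest : 'I_n -> 'I_m)
      (subgrad : R -> 'I_n -> 'rV[R]_m -> 'rV[R]_m)
      (oco : seq 'rV[R]_m -> 'rV[R]_m),
      (1 < m * n)%N ->
      (forall S, 0 <= c S) ->
      is_cover sets [set: 'I_m] ->
      opt sets c <= Est <= 2 * opt sets c ->
      cheapest_rule sets c cheapest ->
      subgradient_rule sets c Est subgrad ->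
      omd_guarantee c Est K oco ->
      expected_alg_cost sets c Est cheapest subgrad oco
        <= C * ln (m * n)%:R * opt sets c.
Proof.
(* Here 3 bounds [1 + ln m] and the inner 8 bounds [4 * ln (1 + n)], both in units of [ln (m * n)];
   the outer 8 is the 4 of the cost bound times the 2 from [Est <= 2 * opt]. The absolute value
   allows [K] of any sign. *)
exists (8 * (3 * `|K| + 8)) => n m sets c Est cheapest subgrad oco.
move=> mn1 c0 cov /andP[optE Eopt] cheap sub omd.
have [ln1 lnm lnn] := ln_bounds R mn1.
have opt0 : 0 <= opt sets c by have [A _ <-] := opt_cover c cov; apply: sumr_ge0.
have kE e : c (cheapest e) <= Est.
  exact: le_trans (cheapest_le_opt e c0 cov cheap) optE.
have [ocoP _] := omd.
have K0 := normr_ge0 K; set L := ln (m * n)%:R in ln1 lnm lnn *.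
have [E0|E0] := leP Est 0.
  apply: le_trans (expected_cost_le0 sets subgrad c0 kE ocoP E0) _.
  by rewrite !mulr_ge0 //; nra.
have [p Pp p1] := opt_fractional cov optE.
apply: (le_trans (expected_cost_bound c0 cheap kE ocoP sub E0 omd Pp p1)).
have KL : K * (1 + ln m%:R) <= `|K| * (3 * L).
  have lnm0 : 0 <= ln m%:R :> R.
    by apply: ln_ge0; rewrite ler1n; move: mn1; case: (m).
  apply: (@le_trans _ _ (`|K| * (1 + ln m%:R))).
    by rewrite ler_wpM2r ?ler_norm // addr_ge0.
  by apply: ler_wpM2l => //; lra.
have bound : K * (1 + ln m%:R) + 4 * ln (1 + n%:R) <= (3 * `|K| + 8) * L by lra.
have L0 : 0 <= (3 * `|K| + 8) * L by nra.
apply: (@le_trans _ _ (4 * ((3 * `|K| + 8) * L) * Est)).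
  by rewrite ler_wpM2r ?(ltW E0) // ler_wpM2l.
apply: (@le_trans _ _ (4 * ((3 * `|K| + 8) * L) * (2 * opt sets c))).
  by rewrite ler_wpM2l // mulr_ge0.
by rewrite le_eqVlt; apply/orP; left; apply/eqP; ring.
Qed.
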